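(* Let $C$ be a positive rational number and let $G$ be a commutative graph of level $h$ with layers $V_0,\dots,V_h$ such that $D_i(G)=C^i$ for all $1\le i\le h$. Then there exists a nonempty $Z\subseteq V_0$ whose channel is a regular commutative graph of ratio $C$.
   Context: A directed layered graph $G$ of level $h$ has vertex set $V(G)=V_0\cup\dots\cup V_h$, a disjoint union of finite sets (layers) with $V_0\ne\emptyset$, and every directed edge goes from some $V_i$ to $V_{i+1}$. For a vertex $x$, $\operatorname{im}(x)$ denotes its set of out-neighbours and $\operatorname{im}^{-1}(x)$ its set of in-neighbours. For $Z\subseteq V(G)$, $\operatorname{im}^{(i)}(Z)$ is the set of vertices reachable from $Z$ by a directed path with $i$ edges. $G$ is commutative if: (upward) for every edge $uv$ there is an injective $\varphi:\operatorname{im}(v)\to\operatorname{im}(u)$ with $\varphi(x)x\in E(G)$ for all $x$; and (downward) for every edge $vw$ there is an injective $\psi:\operatorname{im}^{-1}(v)\to\operatorname{im}^{-1}(w)$ with $x\psi(x)\in E(G)$ for all $x$. $D_i(G)=\min_{\emptyset\neq Z\subseteq V_0}|\operatorname{im}^{(i)}(Z)|/|Z|$. The channel of $Z\subseteq V_0$ is the subgraph formed by all vertices and edges lying on directed paths from $Z$ to $V_h$ (its layers are its intersections with $V_0,\dots,V_h$). A commutative graph of level $h$ is regular of ratio $C$ if there is a positive integer $d$ such that every vertex not in the bottom layer has in-degree $d$ and every vertex not in the top layer has out-degree $Cd$.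
   Formalization: The level h = 1 is excluded: there commutativity is vacuous and the claim fails, e.g. C = 1, V_0 = {a,b,c}, V_1 = {1,2,3}, im(a) = {1,2}, im(b) = {1,2,3}, im(c) = {2,3} has D_1 = 1 but no nonempty Z has a regular channel of ratio 1. *)

(* Defs.v *)
From mathcomp Require Import all_boot all_order all_algebra.

Set Implicit Arguments.
Unset Strict Implicit.
Unset Printing Implicit Defensive.

Import Order.TTheory GRing.Theory Num.Theory.

Local Open Scope ring_scope.

(* Plain MathComp. The vertices of a graph are the elements of its layers, not
   all of the ambient type T, so that subgraphs live on the same T. *)
Record lgraph (T : finType) (h : nat) := LGraph {
  layer : 'I_h.+1 -> {set T};
  edge : rel T
}.

Section LayeredGraph.

Variables (T : finType) (h : nat).
Implicit Types (G : lgraph T h) (Z : {set T}).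

Definition vertices G : {set T} := \bigcup_(i < h.+1) layer G i.

Definition layered G : Prop :=
  [/\ layer G ord0 != set0,
      forall i j : 'I_h.+1, i != j -> [disjoint layer G i & layer G j]
    & forall u v : T, edge G u v ->
        exists i j : 'I_h.+1,
          [/\ u \in layer G i, v \in layer G j & j = i.+1 :> nat]].

Definition im G (x : T) : {set T} := [set y | edge G x y].

Definition imV G (x : T) : {set T} := [set y | edge G y x].

Definition im_iter G (i : nat) Z : {set T} :=
  [set y | [exists z in Z, exists p : i.-tuple T,
              path (edge G) z p && (last z p == y)]].

Definition upward G : Prop :=
  forall u v : T, edge G u v ->
    exists phi : T -> T,
      [/\ {in im G v, forall x, phi x \in im G u},
          {in im G v &, injective phi}
        & {in im G v, forall x, edge G (phi x) x}].

Definition downward G : Prop :=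
  forall v w : T, edge G v w ->
    exists psi : T -> T,
      [/\ {in imV G v, forall x, psi x \in imV G w},
          {in imV G v &, injective psi}
        & {in imV G v, forall x, edge G x (psi x)}].

(* For h = 1 the upward and downward conditions are vacuous: every bipartite
   graph is commutative. Hence tightness of the magnification ratios does not
   force regularity there: V_0 = {a, b, c}, V_1 = {1, 2, 3} with out-neighbours
   a : {1, 2}, b : {1, 2, 3}, c : {2, 3} has D_1 = 1, reached only at Z = V_0,
   and its out-degrees are 2, 3, 2. This is why the level 1 is excluded in the
   statement about tight commutative graphs. *)
Definition commutative_graph G : Prop :=
  [/\ layered G, upward G & downward G].

Definition magnification_ratio G (i : nat) Z : rat :=
  #|im_iter G i Z|%:R / #|Z|%:R.

(* The default value of the iterated minimum is the ratio of the bottom layer,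
   which is itself one of the competitors as soon as that layer is nonempty. *)
Definition D G (i : nat) : rat :=
  \big[Num.min/magnification_ratio G i (layer G ord0)]_(Z : {set T} |
      (Z != set0) && (Z \subset layer G ord0)) magnification_ratio G i Z.

(* In a layered graph, the directed paths from a subset of the bottom layer to
   the top layer all have exactly h edges. *)
Definition channel_path G Z (z : T) (p : h.-tuple T) : bool :=
  [&& z \in Z, path (edge G) z p & last z p \in layer G ord_max].

(* zip (z :: p) p lists the pairs of consecutive vertices of the path z :: p. *)
Definition channel G Z : lgraph T h := {|
  layer := fun i => [set x in layer G i |
    [exists z, exists p : h.-tuple T, channel_path G Z z p && (x \in z :: p)]];
  edge := fun u v =>
    [exists z, exists p : h.-tuple T,
       channel_path G Z z p && ((u, v) \in zip (z :: p) p)]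
|}.

Definition regular_of_ratio (C : rat) G : Prop :=
  exists d : nat,
    [/\ (0 < d)%N,
        forall x, x \in vertices G :\: layer G ord0 -> #|imV G x| = d
      & forall x, x \in vertices G :\: layer G ord_max ->
          #|im G x|%:R = C * d%:R].

End LayeredGraph.

(* Main.v *)
Require Import Defs.
From mathcomp Require Import all_boot all_order all_algebra.

Set Implicit Arguments.
Unset Strict Implicit.
Unset Printing Implicit Defensive.

Import Order.TTheory GRing.Theory Num.Theory.

Local Open Scope ring_scope.

(* Give a vertex of level i the weight C^-i. Let S be a set of minimal weight
   meeting every path from the bottom to the top layer, U = S \cap V_i an
   intermediate part, F (resp. K) the vertices reached from the bottom (resp.
   reaching the top) while avoiding S. Replacing B <= U by its in-neighbours in
   F gives another separator, so those weigh at least as much as B; commutativity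
   makes the out-degree into K of a vertex of U at most the out-degree into U of
   its in-neighbours in F. Summing over the superlevel sets of the degrees,
     sum_U w deg_K^+ <= sum_F w deg_U^+ = C sum_U w deg_F^-
                     <= C sum_K w deg_U^- = sum_U w deg_K^+,
   so all superlevel sets of the degrees keep their weight from one layer to the
   next. In particular S can be pulled down to the bottom layer, which is thus a
   minimal separator (Pluennecke's inequality).
   Now take Z of least cardinality with |im Z| = C |Z|. In its channel every
   layer is a minimal separator. The vertices of Z of small out-degree have a
   neighbourhood of ratio at most C, so by minimality they are all of Z or none,
   and the out-degree is constant. For in-degrees, let B be the vertices of V_1
   of large in-degree; V_1 \ B and the vertices of V_2 of large in-degree form
   another minimal separator, and pulling V_1 \ B down shows that
   { z | im z <= B } has ratio C, so minimality applies again. *)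

(** * Weights of vertex sets *)

Definition weight (T : finType) (w : T -> rat) (A : {set T}) : rat :=
  \sum_(x in A) w x.

Section Weight.

Variables (T : finType) (w : T -> rat).
Hypothesis w_gt0 : forall x, 0 < w x.
Implicit Types A B : {set T}.

Lemma weight_ge0 A : 0 <= weight w A.
Proof. by apply: sumr_ge0 => x _; apply: ltW. Qed.

Lemma weight_set0 : weight w set0 = 0.
Proof. exact: big_set0. Qed.

Lemma weightD A B :
  B \subset A -> weight w (A :\: B) = weight w A - weight w B.
Proof.
move=> /setIidPr defB.
by rewrite [weight w A](big_setID B) /= defB addrC addrK.
Qed.

Lemma weightS A B : A \subset B -> weight w A <= weight w B.
Proof. by move=> sAB; rewrite -subr_ge0 -weightD // weight_ge0. Qed.

Lemma weightU A B : weight w (A :|: B) <= weight w A + weight w B.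
Proof.
rewrite [weight w _](big_setID B) /= addrC lerD ?weightS ?subsetIr //.
by rewrite setDUl setDv setU0 subsetDl.
Qed.

Lemma weight_eqS A B : A \subset B -> weight w B <= weight w A -> A = B.
Proof.
move=> sAB leBA; apply/eqP; rewrite eqEsubset sAB /=; apply/subsetP=> x Bx.
apply/negPn/negP=> Ax.
have : 0 < weight w (B :\: A).
  rewrite /weight (bigD1 x) ?inE ?Ax //= ltr_wpDr //.
  by apply: sumr_ge0 => y _; apply: ltW.
by rewrite weightD // subr_gt0 ltNge leBA.
Qed.

(** Each [x] is counted once for every threshold [t] from 1 to [d x]; exchanging the two sums gives
    the identity. Inequalities between degree sums can then be proved one superlevel set at a
    time. *)
Lemma sum_layer_cake A (d : T -> nat) n :
    (forall x, (d x < n)%N) ->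
  \sum_(x in A) w x *+ d x =
  \sum_(1 <= t < n) weight w [set x in A | (t <= d x)%N].
Proof.
move=> d_lt; rewrite /weight.
under [RHS]eq_bigr do rewrite big_mkcond /=.
rewrite exchange_big big_mkcond /=; apply: eq_bigr => x _.
rewrite (@big_cat_nat _ _ _ (d x).+1) //= [X in _ + X]big_nat_cond.
rewrite [X in _ + X]big1 => [|t /andP[/andP[ltdt _] _]]; last first.
  by rewrite inE leqNgt ltdt andbF.
rewrite addr0 big_nat_cond.
case: ifPn => [Ax|/negPf Ax].
  rewrite (eq_bigr (fun=> w x)) => [|t]; last first.
    by rewrite ltnS inE Ax andbT => /andP[_ ->].
  by rewrite -big_nat_cond sumr_const_nat subn1.
by rewrite big1 // => t _; rewrite inE Ax.
Qed.

End Weight.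

Lemma ler_sum_eq (R : numDomainType) (I : eqType) (r : seq I) (P : pred I)
    (F G : I -> R) :
    (forall i, P i -> F i <= G i) ->
    \sum_(i <- r | P i) G i <= \sum_(i <- r | P i) F i ->
  {in r, forall i, P i -> F i = G i}.
Proof.
move=> leFG leGF i ri Pi.
have : \sum_(i <- r | P i) (G i - F i) == 0.
  by rewrite sumrB subr_eq0 eq_le leGF ler_sum.
rewrite psumr_eq0 => [/allP/(_ i ri)|j Pj]; last by rewrite subr_ge0 leFG.
by rewrite Pi subr_eq0 => /eqP.
Qed.

(** * Minimal separators *)

Definition converse (T : Type) (e : rel T) : rel T := fun x y => e y x.

Section Reach.

Variables (T : finType) (e : rel T) (A S : {set T}).

(** The path must avoid [S] at its first vertex too, hence the start in [A :\: S]. With [S = set0]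
    this is plain reachability from [A]. *)
Definition reach : {set T} :=
  [set x | [exists z in A :\: S, connect (fun u v => e u v && (v \notin S)) z x]].

Lemma reach_src x : x \in A -> x \notin S -> x \in reach.
Proof. by move=> Ax Sx; rewrite inE; apply/existsP; exists x; rewrite !inE Sx Ax connect0. Qed.

Lemma reach_step u v : u \in reach -> e u v -> v \notin S -> v \in reach.
Proof.
rewrite !inE => /existsP[z /andP[zAS zu]] euv Sv; apply/existsP; exists z.
by rewrite zAS (connect_trans zu) // connect1 // euv.
Qed.

Lemma reach_ind (P : T -> Prop) :
    (forall x, x \in A -> x \notin S -> P x) ->
    (forall u v, u \in reach -> P u -> e u v -> v \notin S -> P v) ->
  forall x, x \in reach -> P x.
Proof.
move=> P0 PS x; rewrite inE => /existsP[z /andP[/setDP[Az Sz]]] /connectP[p].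
have rz : z \in reach by apply: reach_src.
elim: p z {Az Sz} (P0 z Az Sz) rz => [|y p IHp] z Pz rz /=; first by move=> _ ->.
move=> /andP[/andP[ezy Sy] pathp] defx; apply: (IHp y) => //.
  exact: PS ezy Sy.
exact: reach_step ezy Sy.
Qed.

Lemma reach_notin x : x \in reach -> x \notin S.
Proof. by move: x; apply: reach_ind. Qed.

End Reach.

Definition separates (T : finType) (e : rel T) (A Z S : {set T}) :=
  [disjoint reach e A S & Z].

Definition min_separator (T : finType) (w : T -> rat) (e : rel T)
    (A Z S : {set T}) : Prop :=
  separates e A Z S /\
  forall S' : {set T}, separates e A Z S' -> weight w S <= weight w S'.

Section Separators.

Variables (T : finType) (w : T -> rat) (e : rel T) (A Z : {set T}).

(** Walking from [x] towards [Z] outside [S] would carry reachability from [A] along, up to a vertex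
    of [Z]. *)
Lemma separatesP S x : separates e A Z S ->
  x \in reach e A S -> x \in reach (converse e) Z S -> False.
Proof.
move=> sepS; suff: x \in reach (converse e) Z S -> ~ x \in reach e A S.
  by move=> nr xA /nr.
move: x; apply: reach_ind => [x Zx _ xr|u v uZ nu euv vS vr].
  by move/pred0P: sepS => /(_ x) /=; rewrite xr Zx.
exact/nu/(reach_step vr euv)/(reach_notin uZ).
Qed.

Lemma converse_separates S :
  separates e A Z S -> separates (converse e) Z A S.
Proof.
move=> sepS; apply/pred0P=> x; apply/negP=> /andP[/= xZ xA].
exact: separatesP sepS (reach_src e xA (reach_notin xZ)) xZ.
Qed.

End Separators.

Lemma converse_min_separator (T : finType) (w : T -> rat) (e : rel T) (A Z S : {set T}) :
  min_separator w e A Z S -> min_separator w (converse e) Z A S.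
Proof.
case=> sepS minS; split=> [|S' /converse_separates]; last exact: minS.
exact: converse_separates.
Qed.

(** Stated for a bare relation, so that the downward condition is the same property of [converse e]
    and each argument below serves in both directions. *)
Definition upward_rel (T : finType) (e : rel T) : Prop :=
  forall u v, e u v -> exists phi : T -> T,
    [/\ forall x, e v x -> e u (phi x),
        {in e v &, injective phi} & forall x, e v x -> e (phi x) x].

Definition deg (T : finType) (e : rel T) (B : {set T}) (u : T) : nat :=
  #|[set v in B | e u v]|.

Definition nbr_above (T : finType) (e : rel T) (F B : {set T}) : {set T} :=
  [set u in F | [exists b in B, e u b]].

(** * Pulling part of a separator back along the edges *)

Section PullDown.

Variables (T : finType) (w : T -> rat) (e : rel T) (A Z S U : {set T}).
Hypothesis w_gt0 : forall x, 0 < w x.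
Hypothesis minS : min_separator w e A Z S.
Hypothesis up_e : upward_rel e.
Hypothesis sUS : U \subset S.
Hypothesis UA : [disjoint U & A].

Let F := reach e A S.
Let K := reach (converse e) Z S.

Hypothesis closedU : forall u b y,
  u \in F -> b \in U -> e u b -> y \in S -> e u y -> y \in U.

(** A path avoiding the new set also avoids [S]: it cannot start in [B], which is disjoint from [A],
    and it could enter [B] only from a vertex of [F] that has just been added to the separator. *)
Lemma pull_separates (B : {set T}) : B \subset U ->
  separates e A Z ((S :\: B) :|: nbr_above e F B).
Proof.
move=> sBU; set S' := _ :|: _.
suff sF : forall x, x \in reach e A S' -> x \in F.
  apply/pred0P=> x; apply/negP=> /andP[/sF /= xF Zx].
  by have /pred0P/(_ x) := minS.1; rewrite /= xF Zx.
apply: reach_ind => [x Ax|u v ur uF euv].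
  rewrite in_setU in_setD negb_or negb_and negbK => /andP[/orP[Bx|Sx] _].
    by have /pred0P/(_ x) := UA; rewrite /= (subsetP sBU) // Ax.
  exact: reach_src.
rewrite in_setU in_setD negb_or negb_and negbK => /andP[/orP[Bv|Sv] _].
  have := reach_notin ur; rewrite in_setU negb_or => /andP[_].
  by rewrite inE uF /= => /existsP[]; exists v; rewrite Bv.
exact: reach_step uF euv Sv.
Qed.

(** A weighted Hall condition: otherwise trading [B] for its in-neighbours in [F] would give a
    lighter separator. *)
Lemma pull_hall (B : {set T}) :
  B \subset U -> weight w B <= weight w (nbr_above e F B).
Proof.
move=> sBU; have /minS.2 := pull_separates sBU.
move/le_trans/(_ (weightU w_gt0 _ _)).
by rewrite weightD ?(subset_trans sBU) // -addrA lerDl addrC subr_ge0.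
Qed.

(** The upward map sends the out-neighbours of [b] in [K] injectively to out-neighbours of [u]. Such
    an image is in [S], since otherwise it would continue a path from [A] into [K] outside [S]; by
    [closedU] it is then in [U]. *)
Lemma upward_deg u b :
  u \in F -> b \in U -> e u b -> (deg e K b <= deg e U u)%N.
Proof.
move=> uF bU eub; have [phi [phi_u phi_inj phi_e]] := up_e eub.
rewrite /deg -(card_in_imset (f := phi)); last first.
  by move=> x y /setIdP[_ bx] /setIdP[_]; apply: phi_inj.
apply/subset_leq_card/subsetP=> _ /imsetP[x /setIdP[xK ebx] ->].
rewrite inE phi_u // andbT.
have eux := phi_u _ ebx; apply: (closedU uF bU eub _ eux).
apply/negPn/negP=> Sphi; apply: (separatesP minS.1 _ xK).
apply: reach_step (phi_e x ebx) _; first exact: reach_step uF eux Sphi.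
exact: (reach_notin (e := converse e) xK).
Qed.

Lemma nbr_above_deg t :
  nbr_above e F [set b in U | (t <= deg e K b)%N] \subset
  [set u in F | (t <= deg e U u)%N].
Proof.
apply/subsetP=> u /setIdP[uF /existsP[b /andP[/setIdP[bU tb] eub]]].
by rewrite inE uF (leq_trans tb) // upward_deg.
Qed.

Lemma weight_level_le t :
  weight w [set b in U | (t <= deg e K b)%N] <=
  weight w [set u in F | (t <= deg e U u)%N].
Proof.
apply: le_trans (weightS w_gt0 (nbr_above_deg t)).
by apply: pull_hall; apply/subsetP=> b /setIdP[].
Qed.

Lemma deg_lt B x : (deg e B x < #|T|.+1)%N.
Proof. by rewrite ltnS max_card. Qed.

Lemma weight_deg_le :
  \sum_(b in U) w b *+ deg e K b <= \sum_(u in F) w u *+ deg e U u.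
Proof.
rewrite (sum_layer_cake _ _ (deg_lt K)) (sum_layer_cake _ _ (deg_lt U)).
by apply: ler_sum => t _; apply: weight_level_le.
Qed.

Lemma weight_deg_eq t :
    \sum_(u in F) w u *+ deg e U u <= \sum_(b in U) w b *+ deg e K b ->
    (0 < t)%N ->
  weight w [set b in U | (t <= deg e K b)%N] =
    weight w [set u in F | (t <= deg e U u)%N].
Proof.
rewrite (sum_layer_cake _ _ (deg_lt K)) (sum_layer_cake _ _ (deg_lt U)).
move=> leFU t_gt0; have [tT|Tt] := ltnP t #|T|.+1.
  apply: (ler_sum_eq (fun t _ => weight_level_le t) leFU) => //.
  by rewrite mem_index_iota t_gt0.
(* Thresholds beyond [#|T|] do not occur in the layer-cake sum; there both superlevel sets are
   empty. *)
have none B X : [set b in X | (t <= deg e B b)%N] = set0.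
  by apply/setP=> x; rewrite !inE leqNgt (leq_trans (deg_lt B x)) ?andbF.
by rewrite !none.
Qed.

End PullDown.

(** Double counting of the edges from [F] to [U], the edge [u v] being counted with weight
    [w u = C * w v]. *)
Lemma weight_deg_converse (T : finType) (w : T -> rat) (e : rel T) (C : rat) (F U : {set T}) :
    (forall u v, e u v -> w u = C * w v) ->
  \sum_(u in F) w u *+ deg e U u = C * \sum_(v in U) w v *+ deg (converse e) F v.
Proof.
move=> wC; rewrite mulr_sumr.
transitivity (\sum_(u in F) \sum_(v in U) (if e u v then C * w v else 0)).
  apply: eq_bigr => u _; rewrite -sumr_const -big_mkcondr /=.
  by apply: eq_big => [v|v /setIdP[_ /wC]//]; rewrite inE.
rewrite exchange_big /=; apply: eq_bigr => v _.
rewrite -big_mkcondr mulrnAr -sumr_const /=.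
by apply: eq_bigl => u; rewrite inE.
Qed.

(** * Equality from pulling in both directions *)

Section TwoSided.

Variables (T : finType) (w : T -> rat) (e : rel T) (A Z S U : {set T}) (C : rat).
Hypothesis w_gt0 : forall x, 0 < w x.
Hypothesis minS : min_separator w e A Z S.
Hypothesis C_gt0 : 0 < C.
Hypothesis wC : forall u v, e u v -> w u = C * w v.
Hypothesis up_e : upward_rel e.
Hypothesis down_e : upward_rel (converse e).
Hypothesis sUS : U \subset S.
Hypothesis UA : [disjoint U & A].
Hypothesis UZ : [disjoint U & Z].

Let F := reach e A S.
Let K := reach (converse e) Z S.

Hypothesis closedF : forall u b y,
  u \in F -> b \in U -> e u b -> y \in S -> e u y -> y \in U.
Hypothesis closedK : forall x b y,
  x \in K -> b \in U -> e b x -> y \in S -> e y x -> y \in U.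

Let minS' := converse_min_separator minS.

(** These are the reverses of [weight_deg_le] for [e] and for [converse e]: double counting turns
    each of those two inequalities into the reverse of the other. *)
Lemma weight_deg_cycle :
  \sum_(u in F) w u *+ deg e U u <= \sum_(b in U) w b *+ deg e K b /\
  \sum_(x in K) w x *+ deg (converse e) U x <=
  \sum_(b in U) w b *+ deg (converse e) F b.
Proof.
have leUF := weight_deg_le w_gt0 minS up_e sUS UA closedF.
have leUK := weight_deg_le w_gt0 minS' down_e sUS UZ closedK.
have eqF := weight_deg_converse F U wC.
have eqU := weight_deg_converse U K wC.
split; first by rewrite eqF eqU ler_pM2l.
by rewrite -(ler_pM2l C_gt0) -eqU -eqF.
Qed.

Lemma pull_out t : (0 < t)%N ->
  weight w [set b in U | (t <= deg e K b)%N] =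
  weight w [set u in F | (t <= deg e U u)%N].
Proof.
exact: weight_deg_eq w_gt0 minS up_e sUS UA closedF t weight_deg_cycle.1.
Qed.

Lemma pull_in t : (0 < t)%N ->
  weight w [set b in U | (t <= deg (converse e) F b)%N] =
  weight w [set x in K | (t <= deg (converse e) U x)%N].
Proof.
exact: weight_deg_eq w_gt0 minS' down_e sUS UZ closedK t weight_deg_cycle.2.
Qed.

Lemma weight_nbr_out : weight w (nbr_above e F U) = weight w U.
Proof.
apply/le_anti/andP; split; last exact: pull_hall minS sUS UA U (subxx U).
(* The in-neighbours of [U] form the superlevel set of threshold 1, so [pull_out] gives them the
   weight of a subset of [U]. *)
have -> : nbr_above e F U = [set u in F | (1 <= deg e U u)%N].
  apply/setP=> u; rewrite !inE; congr (_ && _); rewrite card_gt0.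
  apply/existsP/set0Pn => -[b]; first by move=> bU; exists b; rewrite inE.
  by rewrite inE => bU; exists b.
rewrite -pull_out // weightS //.
by apply/subsetP=> b /setIdP[].
Qed.

End TwoSided.

Lemma exists_min_separator (T : finType) (w : T -> rat) (e : rel T) (A Z : {set T}) :
  exists S, min_separator w e A Z S.
Proof.
have sepT : separates e A Z setT.
  by apply/pred0P=> x; apply/negP=> /andP[/reach_notin]; rewrite inE.
by case: (arg_minP (weight w) sepT) => S sepS minS; exists S.
Qed.

Lemma in_sep (T : finType) (B : {set T}) (P : pred T) x :
  (x \in [set y in B | P y]) = (x \in B) && P x.
Proof. by rewrite inE. Qed.

(** * Layers of a graph of constant ratio *)

Definition level_set (T : finType) (V : {set T}) (lev : T -> nat) (i : nat) :=
  [set x in V | lev x == i].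

(** Normalised so that a layer growing by the factor [C] at each step keeps its weight. *)
Definition level_weight (T : finType) (C : rat) (lev : T -> nat) (x : T) : rat :=
  (C ^+ lev x)^-1.

Section Levels.

Variables (T : finType) (e : rel T) (V : {set T}) (lev : T -> nat) (h : nat).
Variable C : rat.

Local Notation L := (level_set V lev).
Local Notation w := (level_weight C lev).
Let odeg x := #|[set y | e x y]|.
Let ideg x := #|[set y | e y x]|.

Hypothesis C_gt0 : 0 < C.
Hypothesis h_gt1 : (1 < h)%N.
Hypothesis V_l : forall u v, e u v -> u \in V.
Hypothesis V_r : forall u v, e u v -> v \in V.
Hypothesis levS : forall u v, e u v -> lev v = (lev u).+1.
Hypothesis lev_le : forall x, x \in V -> (lev x <= h)%N.
Hypothesis has_out : forall x, x \in V -> (lev x < h)%N -> exists y, e x y.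
Hypothesis has_in : forall x, x \in V -> (0 < lev x)%N -> exists y, e y x.
Hypothesis up_e : upward_rel e.
Hypothesis down_e : upward_rel (converse e).
Hypothesis L0_neq0 : L 0 != set0.
(** The bound [D_h >= C^h], expressed in weights. *)
Hypothesis expand_top : forall B : {set T}, B \subset L 0 ->
  weight w B <= weight w (L h :&: reach e B set0).
Hypothesis tight1 : weight w (L 1) <= weight w (L 0).
(** Minimality of the tight set: no proper nonempty part of the bottom layer has a neighbourhood of
    ratio at most [C]. *)
Hypothesis irr : forall B Y : {set T}, B \subset L 0 ->
  (forall u v, u \in B -> e u v -> v \in Y) -> weight w Y <= weight w B ->
  B = set0 \/ B = L 0.

Lemma level_weight_gt0 x : 0 < w x.
Proof. by rewrite invr_gt0 exprn_gt0. Qed.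
Hint Resolve level_weight_gt0 : core.

Lemma level_weight_edge u v : e u v -> w u = C * w v.
Proof. by move=> /levS levv; rewrite /w levv exprS invfM mulVKf ?gt_eqF. Qed.

Lemma level_weight_converse_edge v u : converse e v u -> w v = C^-1 * w u.
Proof. by move=> /level_weight_edge ->; rewrite mulKf ?gt_eqF. Qed.

Lemma disjoint_level_set i j : i != j -> [disjoint L i & L j].
Proof.
move=> neq_ij; apply/pred0P=> x; apply/negP=> /andP[/setIdP[_ /eqP levx] /setIdP[_]].
by rewrite levx (negPf neq_ij).
Qed.

Section Separator.

Variables (S : {set T}) (i : nat).
Hypothesis minS : min_separator w e (L 0) (L h) S.
Hypotheses (i_gt0 : (0 < i)%N) (lt_ih : (i < h)%N).

Let U := S :&: L i.
Let F := reach e (L 0) S.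
Let K := reach (converse e) (L h) S.

Lemma separator_level_bottom : [disjoint U & L 0].
Proof. by apply: disjointWl (subsetIr _ _) _; rewrite disjoint_level_set // -lt0n. Qed.

Lemma separator_level_top : [disjoint U & L h].
Proof. by apply: disjointWl (subsetIr _ _) _; rewrite disjoint_level_set // ltn_eqF. Qed.

Lemma separator_level_successors u b y :
  u \in F -> b \in U -> e u b -> y \in S -> e u y -> y \in U.
Proof.
move=> _ /setIP[_ /setIdP[_ /eqP levb]] /levS eub Sy euy.
by rewrite !inE Sy (V_r euy) -levb eub (levS euy) /=.
Qed.

Lemma separator_level_predecessors x b y :
  x \in K -> b \in U -> e b x -> y \in S -> e y x -> y \in U.
Proof.
move=> _ /setIP[_ /setIdP[_ /eqP levb]] /levS eub Sy eyx.
by rewrite !inE Sy (V_l eyx) -levb -eqSS -eub (levS eyx) /=.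
Qed.

Let UA := separator_level_bottom.
Let UZ := separator_level_top.
Let closedF := separator_level_successors.
Let closedK := separator_level_predecessors.

Lemma level_weight_nbr_out : weight w (nbr_above e F U) = weight w U.
Proof.
exact: (weight_nbr_out level_weight_gt0 minS C_gt0 level_weight_edge up_e down_e
  (subsetIl _ _) UA UZ closedF closedK).
Qed.

(** Reversing the edges replaces the ratio [C] by its inverse and exchanges the roles of bottom and
    top. *)
Lemma level_weight_nbr_in : weight w (nbr_above (converse e) K U) = weight w U.
Proof.
have Ci_gt0 : 0 < C^-1 by rewrite invr_gt0.
exact: (weight_nbr_out level_weight_gt0 (converse_min_separator minS) Ci_gt0
  level_weight_converse_edge down_e up_e (subsetIl _ _) UZ UA closedK closedF).
Qed.

Definition level_pull_out :=
  pull_out level_weight_gt0 minS C_gt0 level_weight_edge up_e down_e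
    (subsetIl _ _) UA UZ closedF closedK.

Definition level_pull_in :=
  pull_in level_weight_gt0 minS C_gt0 level_weight_edge up_e down_e
    (subsetIl _ _) UA UZ closedF closedK.

End Separator.

(** * Every layer is a minimal separator *)

Lemma min_separator_le S S' : min_separator w e (L 0) (L h) S ->
    separates e (L 0) (L h) S' -> weight w S' <= weight w S ->
  min_separator w e (L 0) (L h) S'.
Proof.
by case=> _ minS sepS' leS'S; split=> // S'' /minS; apply: le_trans.
Qed.

(** Induction on [n], which bounds the number of levels strictly between [k] and [h]. Once the
    levels above [k.+1] are cleared, the part of [S] at level [k.+1] is replaced by its
    in-neighbours at level [k], at no cost in weight. *)
Lemma exists_pulled_separator n k : (h <= k + n.+1)%N ->
  exists2 S, min_separator w e (L 0) (L h) S &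
    forall i, (k < i)%N -> (i < h)%N -> S :&: L i = set0.
Proof.
elim: n k => [|n IHn] k le_h.
  have [S minS] := exists_min_separator w e (L 0) (L h).
  exists S => // i lt_ki lt_ih; have := leq_trans lt_ih le_h.
  by rewrite addn1 ltnS leqNgt lt_ki.
have [|S minS S0] := IHn k.+1; first by rewrite addSnnS.
have [le_hk|lt_kh] := leqP h k.+1.
  exists S => // i lt_ki lt_ih; have := leq_trans lt_ih le_hk.
  by rewrite ltnS leqNgt lt_ki.
set U := S :&: L k.+1; set N := nbr_above e (reach e (L 0) S) U.
exists ((S :\: U) :|: N).
  apply: (min_separator_le minS).
    exact: pull_separates minS (separator_level_bottom _ _) _ (subxx U).
  apply: le_trans (weightU level_weight_gt0 _ _) _.
  by rewrite weightD ?subsetIl // level_weight_nbr_out // subrK.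
move=> i lt_ki lt_ih; apply/setP=> x; rewrite [RHS]inE; apply/negP.
case/setIP=> /setUP[/setDP[xS /negP xU]|xN] xL.
  have [eq_ik|neq_ik] := eqVneq i k.+1; first by apply: xU; rewrite inE xS -eq_ik.
  have : x \in S :&: L i by rewrite inE xS.
  by rewrite S0 ?inE // ltn_neqAle eq_sym neq_ik.
case/setIdP: xL => _ /eqP levx.
case/setIdP: xN => _ /existsP[b /andP[]] /setIP[_ /setIdP[_ /eqP levb]].
move=> /levS; rewrite levb levx => -[eq_ki].
by rewrite eq_ki ltnn in lt_ki.
Qed.

(** After pulling down, [S] meets only the bottom and top levels. Its top part contains all that
    [L 0 :\: S] reaches at the top, hence weighs at least as much as [L 0 :\: S] by [expand_top]; so
    [L 0] is no heavier than [S]. *)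
Lemma bottom_min_separator : min_separator w e (L 0) (L h) (L 0).
Proof.
have [|S minS S0] := @exists_pulled_separator h.-1 0.
  by rewrite add0n prednK // ltnW.
apply: (min_separator_le minS).
  apply/pred0P=> x; apply/negP=> /andP[/= xr _]; move: x xr.
  by apply: reach_ind => // x xL; rewrite xL.
set B := L 0 :\: S; set X := L h :&: reach e B set0.
have sXS : X \subset S :\: L 0.
  (* A path from [B] can meet [S] only at level [h], where it ends. *)
  have reachB x : x \in reach e B set0 -> x \in reach e (L 0) S \/ (lev x = h /\ x \in S).
    move: x; apply: reach_ind => [x /setDP[xL xS] _|u v _ [ur|[levu _]] euv _].
    - by left; apply: reach_src.
    - have [vS|vS] := boolP (v \in S); last by left; apply: reach_step euv vS.
      right; split=> //; apply/eqP; rewrite eqn_leq lev_le ?(V_r euv) //= leqNgt.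
      apply/negP=> lt_vh; suff : v \in S :&: L (lev v) by rewrite S0 ?inE // (levS euv).
      by rewrite !inE vS (V_r euv) /=.
    - by have := lev_le (V_r euv); rewrite (levS euv) levu ltnn.
  apply/subsetP=> x /setIP[xL /reachB[xr|[levx xS]]].
    by have /pred0P/(_ x) := minS.1; rewrite /= xr xL.
  by rewrite !inE xS levx (gtn_eqF (ltnW h_gt1)) andbF.
rewrite [leRHS](big_setID (L 0)) [leLHS](big_setID S) /= setIC lerD2l.
apply: le_trans (weightS level_weight_gt0 sXS); exact: expand_top (subsetDl _ _).
Qed.

(** For the separator [L i], the sets [F] and [K] thus contain all vertices below, respectively
    above, level [i]; degrees relative to them become full degrees. *)
Lemma below_reach i x :
  x \in V -> (lev x < i)%N -> x \in reach e (L 0) (L i).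
Proof.
have [n] := ubnP (lev x); elim: n x => // n IHn x lt_xn Vx lt_xi.
have xi : x \notin L i by rewrite inE ltn_eqF ?andbF.
have [x0|x_gt0] := posnP (lev x); first by apply: reach_src; rewrite // inE Vx x0 /=.
have [y eyx] := has_in Vx x_gt0; have levx := levS eyx.
apply: reach_step (eyx) xi; apply: IHn (V_l eyx) _; rewrite -ltnS -levx //.
exact: ltnW.
Qed.

Lemma above_reach i x :
  x \in V -> (i < lev x)%N -> x \in reach (converse e) (L h) (L i).
Proof.
have [n] := ubnP (h - lev x); elim: n x => // n IHn x lt_xn Vx lt_ix.
have xi : x \notin L i by rewrite inE gtn_eqF ?andbF.
have := lev_le Vx; rewrite leq_eqVlt => /orP[xh|lt_xh].
  by apply: reach_src; rewrite // inE Vx.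
have [y exy] := has_out Vx lt_xh; have levy := levS exy.
apply: (reach_step (e := converse e) (u := y)) xi => //.
apply: IHn (V_r exy) _; rewrite levy; last exact: ltnW.
exact: leq_trans (ltn_sub2l lt_xh (ltnSn _)) lt_xn.
Qed.

Lemma reach_below i x :
  (0 < i)%N -> x \in reach e (L 0) (L i) -> (lev x < i)%N.
Proof.
move=> i_gt0; move: x; apply: reach_ind => [x /setIdP[_ /eqP ->]//|u v _ lt_ui euv].
by rewrite inE (V_r euv) /= ltn_neqAle => ->; rewrite (levS euv).
Qed.

Lemma level_separates i : (0 < i)%N -> (i <= h)%N -> separates e (L 0) (L h) (L i).
Proof.
move=> i_gt0 le_ih; apply/pred0P=> x; apply/negP=> /andP[/reach_below].
by move=> /(_ i_gt0) lt_xi /setIdP[_ /eqP levx]; rewrite ltnNge levx le_ih in lt_xi.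
Qed.

(** Every vertex of [L i.+1] has an in-neighbour in [L i], so [L i.+1] lies in the upward pull of
    [L i], which keeps the weight. The bottom layer cannot be pulled this way, and the step from 0
    to 1 uses [tight1]. *)
Lemma level_min_separator i :
  (i <= h)%N -> min_separator w e (L 0) (L h) (L i).
Proof.
elim: i => [|i IHi] le_ih; first exact: bottom_min_separator.
have [i0|i_gt0] := posnP i.
  rewrite i0; apply: (min_separator_le bottom_min_separator) tight1.
  exact: level_separates (ltnW h_gt1).
have minLi := IHi (ltnW le_ih).
apply: (min_separator_le minLi); first exact: level_separates.
have := level_weight_nbr_in minLi i_gt0 le_ih; rewrite setIid => <-.
apply: (weightS level_weight_gt0); apply/subsetP=> x /setIdP[Vx /eqP levx].
rewrite inE above_reach ?levx //=; apply/existsP.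
have [|y eyx] := has_in Vx; first by rewrite levx.
by exists y; rewrite inE (V_l eyx) /converse eyx -eqSS -(levS eyx) levx eqxx.
Qed.

Lemma weight_level_set i : (i <= h)%N -> weight w (L i) = weight w (L 0).
Proof.
move=> /level_min_separator[sepi mini]; have [sep0 min0] := bottom_min_separator.
by apply/le_anti/andP; split; [apply: mini | apply: min0].
Qed.

(** * Constancy of the degrees *)

Lemma odeg_le u v : e u v -> (odeg v <= odeg u)%N.
Proof.
move=> /up_e[phi [phi_u phi_inj _]]; rewrite /odeg -(card_in_imset (f := phi)).
  apply/subset_leq_card/subsetP=> _ /imsetP[x evx ->]; move: evx; rewrite !inE.
  exact: phi_u.
by move=> x y; rewrite !inE; apply: phi_inj.
Qed.

Lemma ideg_le u v : e u v -> (ideg u <= ideg v)%N.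
Proof.
move=> /down_e[phi [phi_u phi_inj _]]; rewrite /ideg -(card_in_imset (f := phi)).
  apply/subset_leq_card/subsetP=> _ /imsetP[x evx ->]; move: evx; rewrite !inE.
  exact: phi_u.
by move=> x y; rewrite !inE; apply: phi_inj.
Qed.

(** This is [pull_out] for the separator [L i.+1]. Since [t] is positive, the vertices of [F] below
    level [i], which send no edge into [L i.+1], drop out. *)
Lemma odeg_level_weight i t : (0 < t)%N -> (i.+1 < h)%N ->
  weight w [set x in L i.+1 | (t <= odeg x)%N] =
  weight w [set x in L i | (t <= odeg x)%N].
Proof.
move=> t_gt0 lt_ih; have minL := level_min_separator (ltnW lt_ih).
have := level_pull_out minL (ltn0Sn i) lt_ih t_gt0; rewrite setIid => eqw.
transitivity (weight w
    [set x in L i.+1 | (t <= deg e (reach (converse e) (L h) (L i.+1)) x)%N]).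
  congr weight; apply/setP=> x; rewrite !in_sep; apply: andb_id2l => /andP[Vx /eqP levx].
  congr (_ <= _)%N; apply: eq_card => y; rewrite in_sep in_set.
  have [exy|//] := boolP (e x y); last by rewrite andbF.
  by rewrite above_reach ?(V_r exy) // (levS exy) levx.
rewrite eqw; congr weight; apply/setP=> u; rewrite !in_sep.
have degL : u \in V -> lev u = i -> deg e (L i.+1) u = odeg u.
  move=> Vu levu; apply: eq_card => y; rewrite !in_sep in_set.
  have [euy|//] := boolP (e u y); last by rewrite andbF.
  by rewrite (V_r euy) (levS euy) levu eqxx.
apply/andP/andP=> [[uF]|[/andP[Vu /eqP levu]]]; last first.
  by rewrite degL // below_reach // levu.
move=> le_t; have /card_gt0P[b] := leq_trans t_gt0 le_t.
case/setIdP=> /setIdP[_ /eqP levb] eub; move: (levS eub).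
rewrite levb => -[levu]; rewrite (V_l eub) -levu eqxx.
by split=> //; rewrite -degL // (V_l eub).
Qed.

Lemma ideg_level_weight i t : (0 < t)%N -> (0 < i)%N -> (i < h)%N ->
  weight w [set x in L i.+1 | (t <= ideg x)%N] =
  weight w [set x in L i | (t <= ideg x)%N].
Proof.
move=> t_gt0 i_gt0 lt_ih; have minL := level_min_separator (ltnW lt_ih).
have := level_pull_in minL i_gt0 lt_ih t_gt0; rewrite setIid => eqw.
apply/esym; transitivity (weight w
    [set x in L i | (t <= deg (converse e) (reach e (L 0) (L i)) x)%N]).
  congr weight; apply/setP=> x; rewrite !in_sep; apply: andb_id2l => /andP[Vx /eqP levx].
  congr (_ <= _)%N; apply: eq_card => y; rewrite in_sep in_set /converse.
  have [eyx|//] := boolP (e y x); last by rewrite andbF.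
  by rewrite below_reach ?(V_l eyx) // -levx (levS eyx).
rewrite eqw; congr weight; apply/setP=> u; rewrite !in_sep.
have degL : u \in V -> lev u = i.+1 -> deg (converse e) (L i) u = ideg u.
  move=> Vu levu; apply: eq_card => y; rewrite !in_sep in_set /converse.
  have [eyu|//] := boolP (e y u); last by rewrite andbF.
  by rewrite (V_l eyu) -eqSS -(levS eyu) levu eqxx.
apply/andP/andP=> [[uF]|[/andP[Vu /eqP levu]]]; last first.
  by rewrite degL // above_reach // levu.
move=> le_t; have /card_gt0P[b] := leq_trans t_gt0 le_t.
case/setIdP=> /setIdP[_ /eqP levb] ebu; move: (levS ebu).
rewrite levb => levu; rewrite (V_r ebu) levu eqxx.
by split=> //; rewrite -degL // (V_r ebu).
Qed.

(** Out-degrees do not increase along edges, so the vertices of [L 0] of out-degree below [t] have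
    all their out-neighbours among those of [L 1] with the same property. Both sets weigh the same,
    and [irr] applies. *)
Lemma odeg_bottom t : (0 < t)%N ->
  [set u in L 0 | (t <= odeg u)%N] = set0 \/ [set u in L 0 | (t <= odeg u)%N] = L 0.
Proof.
move=> t_gt0; set P := [set u in L 0 | _].
set P1 := [set b in L 1 | (t <= odeg b)%N].
have sPL : P \subset L 0 by apply/subsetP=> u /setIdP[].
have sP1L : P1 \subset L 1 by apply/subsetP=> u /setIdP[].
have [||/eqP|eqL] := @irr (L 0 :\: P) (L 1 :\: P1) (subsetDl _ _).
- move=> u v /setDP[uL uP] euv; have /setIdP[_ /eqP levu] := uL.
  rewrite in_setD !in_sep (V_r euv) (levS euv) levu eqxx !andbT /=.
  apply: contra uP => tv; rewrite in_sep uL /=.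
  exact: leq_trans tv (odeg_le euv).
- by rewrite !weightD // /P1 odeg_level_weight // lerD2r.
- by rewrite setD_eq0 => sLP; right; apply/eqP; rewrite eqEsubset sPL.
- left; apply/setP=> u; rewrite in_set0; apply/negP=> uP.
  by have := subsetP sPL u uP; rewrite -eqL in_setD uP.
Qed.

Lemma ideg_first t : (0 < t)%N ->
  [set b in L 1 | (t <= ideg b)%N] = set0 \/ [set b in L 1 | (t <= ideg b)%N] = L 1.
Proof.
move=> t_gt0; set B := [set b in L 1 | _].
set M := [set x in L 2 | (t <= ideg x)%N].
have sBL : B \subset L 1 by apply/subsetP=> u /setIdP[].
have sML : M \subset L 2 by apply/subsetP=> u /setIdP[].
have wM : weight w M = weight w B by apply: ideg_level_weight.
have [_ min1] := level_min_separator (ltnW h_gt1).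
pose S := (L 1 :\: B) :|: M.
have S0 x : x \in L 0 -> x \notin S.
  move=> /setIdP[_ /eqP levx]; apply/negP=> /setUP[/setDP[/setIdP[_]]|].
    by rewrite levx.
  by move=> /(subsetP sML)/setIdP[_]; rewrite levx.
(* A path from the bottom that avoids [L 1 :\: B] passes through [B]; in-degrees do not decrease
   along edges, so its next vertex is in [M]. *)
have minS : min_separator w e (L 0) (L h) S.
  apply: (min_separator_le (level_min_separator (ltnW h_gt1))); last first.
    apply: le_trans (weightU level_weight_gt0 _ _) _.
    by rewrite weightD // wM subrK.
  have low x : x \in reach e (L 0) S -> lev x = 0%N \/ x \in B.
    move: x; apply: reach_ind => [x /setIdP[_ /eqP ->]|u v _]; first by left.
    case=> [levu|uB] euv.
      rewrite in_setU negb_or in_setD negb_and negbK => /andP[/orP[vB|vL] _].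
        by right.
      by case/negP: vL; rewrite in_sep (V_r euv) (levS euv) levu eqxx.
    move=> /negP[]; apply/setUP; right.
    have /setIdP[/setIdP[_ /eqP levu] tu] := uB.
    rewrite in_sep in_sep (V_r euv) (levS euv) levu eqxx /=.
    exact: leq_trans tu (ideg_le euv).
  apply/pred0P=> x; apply/negP=> /andP[/low lowx /setIdP[_ /eqP levx]].
  case: lowx => [levx0|/(subsetP sBL)/setIdP[_]].
    by have := h_gt1; rewrite -levx levx0.
  by rewrite levx gtn_eqF.
have SL1 : S :&: L 1 = L 1 :\: B.
  apply/setP=> x; rewrite in_setI in_setU; apply/andP/idP => [[/orP[//|xM] xL]|xL].
    have /setIdP[_ /eqP lev1] := xL; have /(subsetP sML)/setIdP[_] := xM.
    by rewrite lev1.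
  by rewrite xL; have /setDP[] := xL.
(* Pulling [L 1 :\: B] down yields [N] of the same weight. So [L 0 :\: N] weighs as much as [B], and
   it has all its out-neighbours in [B]. *)
have := level_weight_nbr_out minS (ltn0Sn 0) h_gt1; rewrite SL1.
set N := nbr_above _ _ _ => wN.
have sNL : N \subset L 0.
  apply/subsetP=> u /setIdP[_ /existsP[b /andP[/setDP[/setIdP[_ /eqP levb] _] eub]]].
  by rewrite in_sep (V_l eub) -eqSS -(levS eub) levb eqxx.
have wL1 := weight_level_set (ltnW h_gt1).
have wLN : weight w (L 0 :\: N) = weight w B.
  by rewrite weightD // wN weightD // wL1 opprD opprK addrA subrr add0r.
have [||eq0|eqL] := @irr (L 0 :\: N) B (subsetDl _ _).
- move=> u v /setDP[uL uN] euv; apply: contraR uN => vB.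
  rewrite in_sep reach_src ?S0 //=; apply/existsP; exists v.
  have /setIdP[_ /eqP levu] := uL.
  by rewrite in_setD vB in_sep (V_r euv) (levS euv) levu eqxx.
- by rewrite wLN.
- left; apply/esym/(weight_eqS level_weight_gt0); first exact: sub0set.
  by rewrite -wLN eq0.
- by right; apply: (weight_eqS level_weight_gt0) => //; rewrite -wLN eqL wL1.
Qed.

(** At each threshold the superlevel set in [L i] is empty or full. As the layers weigh the same,
    equality of weights makes the one in [L j] empty or full accordingly, so [d x] and [d y] pass
    the same thresholds. *)
Lemma degree_transfer (d : T -> nat) i j x y : (i <= h)%N -> (j <= h)%N ->
    (forall t, (0 < t)%N ->
       weight w [set x in L i | (t <= d x)%N] = weight w [set x in L j | (t <= d x)%N]) ->
    (forall t, (0 < t)%N ->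
       [set x in L i | (t <= d x)%N] = set0 \/ [set x in L i | (t <= d x)%N] = L i) ->
  x \in L i -> y \in L j -> d x = d y.
Proof.
move=> le_ih le_jh wd triv Lx Ly.
have le_d t : (t <= d x)%N = (t <= d y)%N.
  have [->//|t_gt0] := posnP t; have wdt := wd t t_gt0.
  have sL : [set x in L j | (t <= d x)%N] \subset L j by apply/subsetP=> z /setIdP[].
  have memx : (x \in [set x in L i | (t <= d x)%N]) = (t <= d x)%N by rewrite in_sep Lx.
  have memy : (y \in [set x in L j | (t <= d x)%N]) = (t <= d y)%N by rewrite in_sep Ly.
  rewrite -memx -memy; case: (triv t t_gt0) => eqX; rewrite eqX in wdt *.
    rewrite -(weight_eqS level_weight_gt0 (sub0set [set x in L j | (t <= d x)%N])) ?inE //.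
    by rewrite -wdt.
  rewrite Lx (weight_eqS level_weight_gt0 sL) ?Ly //.
  by rewrite -wdt !weight_level_set.
by apply/eqP; rewrite eqn_leq -le_d leqnn le_d leqnn.
Qed.

Lemma odeg_const x y :
  x \in L 0 -> y \in V -> (lev y < h)%N -> odeg x = odeg y.
Proof.
move=> Lx Vy lt_yh; apply: (@degree_transfer odeg 0 (lev y)) => //.
- exact: ltnW.
- move=> t t_gt0; elim: (lev y) lt_yh => // i IHi lt_ih.
  by rewrite odeg_level_weight // IHi // ltnW.
- exact: odeg_bottom.
- by rewrite in_sep Vy eqxx.
Qed.

Lemma ideg_const x y :
  x \in L 1 -> y \in V -> (0 < lev y)%N -> ideg x = ideg y.
Proof.
move=> Lx Vy y_gt0; have le_yh := lev_le Vy.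
apply: (@degree_transfer ideg 1 (lev y)) => //; first exact: ltnW.
- move=> t t_gt0; elim: (lev y) y_gt0 le_yh => // -[//|i] IHi _ lt_ih.
  by rewrite [RHS]ideg_level_weight // IHi // ltnW.
- exact: ideg_first.
- by rewrite in_sep Vy eqxx.
Qed.

Lemma levels_regular : exists d : nat,
  [/\ (0 < d)%N,
      forall x, x \in V -> (0 < lev x)%N -> #|[set y | e y x]| = d
    & forall x, x \in V -> (lev x < h)%N -> #|[set y | e x y]|%:R = C * d%:R].
Proof.
have [x0 L0x] := set0Pn _ L0_neq0; have /setIdP[Vx0 /eqP lev0] := L0x.
have [|x1 e01] := has_out Vx0; first by rewrite lev0 ltnW.
have L1x : x1 \in L 1 by rewrite in_sep (V_r e01) (levS e01) lev0 eqxx.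
exists (ideg x1); split.
- by apply/card_gt0P; exists x0; rewrite inE.
- by move=> x Vx x_gt0; rewrite -/(ideg x) -(ideg_const L1x).
move=> x Vx lt_xh; rewrite -/(odeg x) -(odeg_const L0x) //.
(* Counting the edges between the first two layers, which have equal positive weight, relates the
   two constant degrees by the factor [C]. *)
have := weight_deg_converse (L 0) (L 1) level_weight_edge.
rewrite (eq_bigr (fun u => w u *+ odeg x0)); last first.
  move=> u Lu; have /setIdP[Vu /eqP levu] := Lu.
  rewrite (odeg_const L0x Vu) ?levu ?(ltnW h_gt1) //; congr (_ *+ _).
  apply: eq_card => y; rewrite in_sep in_set; have [euy|//] := boolP (e u y); last by rewrite andbF.
  by rewrite in_sep (V_r euy) (levS euy) levu eqxx.
rewrite [X in _ = _ * X](eq_bigr (fun v => w v *+ ideg x1)); last first.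
  move=> v Lv; have /setIdP[Vv /eqP levv] := Lv.
  rewrite (ideg_const L1x Vv) ?levv //; congr (_ *+ _).
  apply: eq_card => y; rewrite in_sep in_set /converse.
  have [eyv|//] := boolP (e y v); last by rewrite andbF.
  by rewrite in_sep (V_l eyv) -eqSS -(levS eyv) levv eqxx.
rewrite !sumrMnl -!/(weight w _) (weight_level_set (ltnW h_gt1)).
rewrite -[_ *+ odeg x0]mulr_natr -[_ *+ ideg x1]mulr_natr mulrCA => /mulfI; apply.
rewrite gt_eqF // /weight (bigD1 x0) //= ltr_wpDr //.
by apply: sumr_ge0 => y _; apply: ltW.
Qed.

End Levels.

(** * Channels *)

Lemma reach0P (T : finType) (e : rel T) (A : {set T}) x :
  reflect (exists z p, [/\ z \in A, path e z p & last z p = x])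
          (x \in reach e A set0).
Proof.
apply: (iffP idP).
  move: x; apply: reach_ind => [x Ax _|u v _ [z [p [Az ezp lastp]]] euv _].
    by exists x, [::].
  by exists z, (rcons p v); rewrite rcons_path last_rcons ezp lastp.
case=> z [p [Az ezp <-]]; have : z \in reach e A set0 by rewrite reach_src ?inE.
elim: p z {Az} ezp => //= y p IHp z /andP[ezy eyp] rz.
by apply: IHp => //; apply: reach_step rz ezy _; rewrite inE.
Qed.

Lemma converse_reach0P (T : finType) (e : rel T) (A : {set T}) x :
  reflect (exists2 p, path e x p & last x p \in A)
          (x \in reach (converse e) A set0).
Proof.
apply: (iffP idP).
  move: x; apply: reach_ind => [x Ax _|u v _ [p eup lastp] evu _].
    by exists [::].
  by exists (u :: p) => //=; rewrite eup andbT.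
case=> p; elim: p x => [|y p IHp] x /= => [_ Ax|/andP[exy eyp] lastp].
  by rewrite reach_src ?inE.
by apply: (reach_step (e := converse e) (IHp y eyp lastp)); rewrite ?inE.
Qed.

Lemma mem_zip_path (T : eqType) (z u v : T) (p : seq T) :
  reflect (exists p1 p2, p = p1 ++ v :: p2 /\ u = last z p1)
          ((u, v) \in zip (z :: p) p).
Proof.
elim: p z => [|y p IHp] z /=.
  by right=> -[[|? ?] [? []]].
rewrite inE; apply: (iffP orP) => [[/eqP[-> ->]|/(IHp y)[p1 [p2 [-> ->]]]]|].
- by exists [::], p.
- by exists (y :: p1), p2.
case=> -[|y1 p1] [p2 [/= [def_y def_p] def_u]].
  by left; rewrite def_y def_u.
by right; apply/(IHp y); exists p1, p2; rewrite def_u def_y.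
Qed.

Section Channel.

Variables (T : finType) (h : nat) (G : lgraph T h).
Hypothesis layG : layered G.

(** The value 0 outside the layers is a dummy, so a level determines a layer only for elements of
    [vertices G]. *)
Definition level x : nat :=
  if [pick i | x \in layer G i] is Some i then i else 0%N.

Lemma levelE i x : x \in layer G i -> level x = i.
Proof.
have [_ disjG _] := layG; rewrite /level => xi.
case: pickP => [j xj|/(_ i)]; last by rewrite xi.
congr nat_of_ord; apply/eqP; apply: contraT => /disjG/pred0P/(_ x).
by rewrite /= xi xj.
Qed.

Lemma level_le x : (level x <= h)%N.
Proof. by rewrite /level; case: pickP => // i _; rewrite -ltnS. Qed.

Lemma level_layer x (i : 'I_h.+1) :
  x \in vertices G -> level x = i -> x \in layer G i.
Proof.
move=> /bigcupP[j _ xj]; rewrite (levelE xj) => /val_inj <- //.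
Qed.

Lemma edge_vertices u v : edge G u v -> (u \in vertices G) && (v \in vertices G).
Proof.
have [_ _ eG] := layG; move=> /eG[i [j [ui vj _]]].
by apply/andP; split; apply/bigcupP; [exists i | exists j].
Qed.

Lemma edge_level u v : edge G u v -> level v = (level u).+1.
Proof.
have [_ _ eG] := layG; move=> /eG[i [j [ui vj eqj]]].
by rewrite (levelE ui) (levelE vj).
Qed.

Lemma path_level x p :
  path (edge G) x p -> level (last x p) = (level x + size p)%N.
Proof.
elim: p x => [|y p IHp] x /=; first by rewrite addn0.
by move=> /andP[/edge_level exy /IHp ->]; rewrite exy addSnnS.
Qed.

Variable Z : {set T}.
Hypothesis sZ0 : Z \subset layer G ord0.

Let fromZ := reach (edge G) Z set0.
Let toTop := reach (converse (edge G)) (layer G ord_max) set0.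
Let H := channel G Z.

Lemma level_source z : z \in Z -> level z = 0%N.
Proof. by move=> /(subsetP sZ0)/levelE. Qed.

(** Each edge raises the level by one; this reconciles arbitrary paths with the [h]-tuples in the
    definition of the channel. *)
Lemma channel_size z p : z \in Z -> path (edge G) z p ->
  last z p \in layer G ord_max -> size p == h.
Proof.
by move=> Zz ezp /levelE; rewrite path_level // level_source // add0n => ->.
Qed.

Lemma channel_edgeP u v :
  reflect [/\ edge G u v, u \in fromZ & v \in toTop] (edge H u v).
Proof.
apply: (iffP existsP) => [[z /existsP[p /andP[/and3P[Zz ezp topp]]]]|].
  move=> /mem_zip_path[p1 [p2 [defp defu]]].
  move: ezp topp; rewrite defp cat_path last_cat /= -defu => /and3P[e1 euv e2] top2.
  split=> //; first by apply/reach0P; exists z, p1.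
  by apply/converse_reach0P; exists p2.
case=> euv /reach0P[z [p1 [Zz e1 lastp1]]] /converse_reach0P[p2 e2 top2].
have ep : path (edge G) z (p1 ++ v :: p2) by rewrite cat_path e1 /= lastp1 euv.
have topp : last z (p1 ++ v :: p2) \in layer G ord_max by rewrite last_cat.
exists z; apply/existsP; exists (Tuple (channel_size Zz ep topp)).
rewrite /channel_path Zz ep topp /=; apply/mem_zip_path.
by exists p1, p2.
Qed.

Lemma channel_layer i :
  layer H i = layer G i :&: (fromZ :&: toTop).
Proof.
apply/setP=> x; rewrite in_sep !in_setI; apply: andb_id2l => _.
apply/existsP/andP => [[z /existsP[p /andP[/and3P[Zz ezp topp] xp]]]|].
  case/splitPl: xp ezp topp => p1 p2 last1; rewrite cat_path last_cat last1.
  move=> /andP[e1 e2] top2; split; first by apply/reach0P; exists z, p1.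
  by apply/converse_reach0P; exists p2.
case=> /reach0P[z [p1 [Zz e1 lastp1]]] /converse_reach0P[p2 e2 top2].
have ep : path (edge G) z (p1 ++ p2) by rewrite cat_path e1 /= lastp1.
have topp : last z (p1 ++ p2) \in layer G ord_max by rewrite last_cat lastp1.
exists z; apply/existsP; exists (Tuple (channel_size Zz ep topp)).
rewrite /channel_path Zz ep topp /= -cat_cons mem_cat -lastp1.
by rewrite mem_last.
Qed.

Lemma channel_vertices : vertices H = vertices G :&: (fromZ :&: toTop).
Proof.
rewrite /vertices (eq_bigr _ (fun i _ => channel_layer i)).
by apply/esym/big_distrl.
Qed.

End Channel.

Lemma upwardE (T : finType) (h : nat) (G : lgraph T h) :
  upward G <-> upward_rel (edge G).
Proof.
split=> up u v /up[phi [phi_u phi_inj phi_e]]; exists phi; split.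
- by move=> x vx; have := phi_u x; rewrite !inE; apply.
- by move=> x y vx vy; apply: phi_inj; rewrite inE.
- by move=> x vx; apply: phi_e; rewrite inE.
- by move=> x; rewrite !inE; apply: phi_u.
- by move=> x y; rewrite !inE; apply: phi_inj.
- by move=> x; rewrite !inE; apply: phi_e.
Qed.

Lemma downwardE (T : finType) (h : nat) (G : lgraph T h) :
  downward G <-> upward_rel (converse (edge G)).
Proof.
split=> down u v.
  move=> /down[phi [phi_u phi_inj phi_e]]; exists phi; split.
  - by move=> x vx; have := phi_u x; rewrite !inE; apply.
  - by move=> x y vx vy; apply: phi_inj; rewrite inE.
  - by move=> x vx; apply: phi_e; rewrite inE.
move=> euv; have [phi [phi_u phi_inj phi_e]] := down v u euv; exists phi; split.
- by move=> x; rewrite !inE; apply: phi_u.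
- by move=> x y; rewrite !inE; apply: phi_inj.
- by move=> x; rewrite !inE; apply: phi_e.
Qed.

(** * Commutativity of channels *)

Section ChannelCommutative.

Variables (T : finType) (h : nat) (G : lgraph T h).
Hypothesis commG : commutative_graph G.
Variable Z : {set T}.
Hypothesis sZ0 : Z \subset layer G ord0.

Let fromZ := reach (edge G) Z set0.
Let toTop := reach (converse (edge G)) (layer G ord_max) set0.
Let H := channel G Z.

Let layG : layered G.
Proof. by case: commG. Qed.

Let edgeP := channel_edgeP layG sZ0.

Lemma from_step u v : edge G u v -> u \in fromZ -> v \in fromZ.
Proof. by move=> euv uZ; apply: reach_step uZ euv _; rewrite inE. Qed.

Lemma top_step u v : edge G u v -> v \in toTop -> u \in toTop.
Proof.
by move=> euv vt; apply: (reach_step (e := converse (edge G)) vt euv); rewrite inE.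
Qed.

(** The map given by [G] works unchanged: [phi x] lies between [u] and [x], so it is reachable from
    [Z] and leads to the top. *)
Lemma channel_upward : upward_rel (edge H).
Proof.
move=> u v /edgeP[euv uZ vt]; have [_ /upwardE up _] := commG.
have [phi [phi_u phi_inj phi_e]] := up _ _ euv; exists phi; split.
- move=> x /edgeP[evx vZ xt]; apply/edgeP; split=> //; first exact: phi_u.
  exact: top_step (phi_e x evx) xt.
- by move=> x y /edgeP[evx _ _] /edgeP[evy _ _]; apply: phi_inj.
- move=> x /edgeP[evx vZ xt]; apply/edgeP; split=> //; first exact: phi_e.
  exact: from_step (phi_u x evx) uZ.
Qed.

Lemma channel_downward : upward_rel (converse (edge H)).
Proof.
move=> v u /edgeP[euv uZ vt]; have [_ _ /downwardE down] := commG.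
have [phi [phi_u phi_inj phi_e]] := down _ _ euv; exists phi; split.
- move=> x /edgeP[evx xZ ut]; apply/edgeP; split=> //; first exact: phi_u.
  exact: from_step (phi_e x evx) xZ.
- by move=> x y /edgeP[evx _ _] /edgeP[evy _ _]; apply: phi_inj.
- move=> x /edgeP[evx xZ ut]; apply/edgeP; split=> //; first exact: phi_e.
  exact: top_step (phi_u x evx) vt.
Qed.

Lemma channel_commutative : layer H ord0 != set0 -> commutative_graph H.
Proof.
move=> H0; split; first split=> //.
- have [_ disjG _] := layG; move=> i j /disjG disj; rewrite !channel_layer //.
  exact: disjointW (subsetIl _ _) (subsetIl _ _) disj.
- move=> u v /edgeP[euv uZ vt]; have [_ _ /(_ u v euv)[i [j [ui vj eqj]]]] := layG.
  exists i, j; rewrite !channel_layer // !in_setI ui vj uZ vt.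
  by rewrite (from_step euv uZ) (top_step euv vt).
- exact/upwardE/channel_upward.
- exact/downwardE/channel_downward.
Qed.

Lemma channel_level_set (i : 'I_h.+1) :
  level_set (vertices H) (level G) i = layer H i.
Proof.
apply/setP=> x; rewrite channel_vertices // channel_layer // in_sep !in_setI.
rewrite andbAC; congr (_ && _); apply/andP/idP => [[xV /eqP levx]|xi].
  exact: level_layer.
by rewrite (levelE layG xi) eqxx; split=> //; apply/bigcupP; exists i.
Qed.

Lemma channel_V_l u v : edge H u v -> u \in vertices H.
Proof.
case/edgeP=> euv uZ vt; have /andP[Vu Vv] := edge_vertices layG euv.
by rewrite channel_vertices // !in_setI Vu uZ (top_step euv vt).
Qed.

Lemma channel_V_r u v : edge H u v -> v \in vertices H.
Proof.
case/edgeP=> euv uZ vt; have /andP[Vu Vv] := edge_vertices layG euv.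
by rewrite channel_vertices // !in_setI Vv vt (from_step euv uZ).
Qed.

Lemma channel_levS u v : edge H u v -> level G v = (level G u).+1.
Proof. by case/edgeP=> euv _ _; apply: edge_level. Qed.

Lemma channel_has_out x :
  x \in vertices H -> (level G x < h)%N -> exists y, edge H x y.
Proof.
rewrite channel_vertices // !in_setI => /and3P[Vx xZ /converse_reach0P[[|y p]]] /=.
  by move=> _ /(levelE layG) ->; rewrite ltnn.
move=> /andP[exy eyp] lasty _; exists y; apply/edgeP; split=> //.
by apply/converse_reach0P; exists p.
Qed.

Lemma channel_has_in x :
  x \in vertices H -> (0 < level G x)%N -> exists y, edge H y x.
Proof.
rewrite channel_vertices // !in_setI => /and3P[Vx /reach0P[z [p [Zz ep lp]]] xt].
case/lastP: p ep lp => [|p y] /=.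
  by move=> _ <-; rewrite (level_source layG sZ0).
rewrite rcons_path last_rcons => /andP[ezp ey] def_y _; exists (last z p).
apply/edgeP; split=> //; first by rewrite -def_y.
by apply/reach0P; exists z, p.
Qed.

End ChannelCommutative.

(** * Iterated images and magnification ratios *)

Lemma im_iterP (T : finType) (h : nat) (G : lgraph T h) i (Z : {set T}) y :
  reflect (exists z p, [/\ z \in Z, path (edge G) z p, last z p = y & size p = i])
          (y \in im_iter G i Z).
Proof.
rewrite inE; apply: (iffP existsP) => [[z /andP[Zz /existsP[p /andP[ep /eqP lp]]]]|].
  by exists z, p; rewrite size_tuple.
case=> z [p [Zz ep lp /eqP sp]]; exists z; rewrite Zz /=; apply/existsP.
by exists (Tuple sp); rewrite /= ep lp eqxx.
Qed.

Lemma im_iter1P (T : finType) (h : nat) (G : lgraph T h) (Z : {set T}) y :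
  reflect (exists2 z, z \in Z & edge G z y) (y \in im_iter G 1 Z).
Proof.
apply: (iffP (im_iterP _ _ _ _)) => [[z [p [Zz ep lp sp]]]|[z Zz ezy]].
  by case: p ep lp sp => [|x []] //=; rewrite andbT => ezx <- _; exists z.
by exists z, [:: y]; rewrite /= ezy.
Qed.

Lemma D_le (T : finType) (h : nat) (G : lgraph T h) i (Z : {set T}) :
  Z != set0 -> Z \subset layer G ord0 ->
  D G i * #|Z|%:R <= #|im_iter G i Z|%:R.
Proof.
move=> Z0 sZ; have cardZ : 0 < #|Z|%:R :> rat by rewrite ltr0n card_gt0.
rewrite -ler_pdivlMr //; apply: (bigmin_le_cond _ (magnification_ratio G i)).
by rewrite Z0.
Qed.

Lemma D_attained (T : finType) (h : nat) (G : lgraph T h) i :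
  layer G ord0 != set0 ->
  exists Z : {set T}, [/\ Z != set0, Z \subset layer G ord0
    & #|im_iter G i Z|%:R = D G i * #|Z|%:R].
Proof.
move=> G0; pose P (Z : {set T}) := (Z != set0) && (Z \subset layer G ord0).
have P0 : P (layer G ord0) by rewrite /P G0 subxx.
rewrite /D; set m := magnification_ratio G i (layer G ord0).
have [Z /andP[Z0 sZ] eqZ] : exists2 Z, P Z & magnification_ratio G i Z =
    \big[Num.min/m]_(Z : {set T} | P Z) magnification_ratio G i Z.
  (* Being the ratio of an admissible set is preserved by minima, and the default value is the ratio
     of the bottom layer. *)
  elim/big_ind: _ => [|x y [X PX <-] [Y PY <-]|Z PZ]; first by exists (layer G ord0).
    by rewrite minEle; case: ifP; [exists X | exists Y].
  by exists Z.
exists Z; split=> //; rewrite -eqZ /magnification_ratio divfK //.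
by rewrite pnatr_eq0 cards_eq0.
Qed.

Lemma weight_sub_level_set (T : finType) (V : {set T}) (lev : T -> nat) (C : rat) i
    (B : {set T}) :
  B \subset level_set V lev i ->
  weight (level_weight C lev) B = #|B|%:R / C ^+ i.
Proof.
move=> sB; rewrite /weight (eq_bigr (fun=> (C ^+ i)^-1)) => [|x Bx].
  by rewrite sumr_const mulr_natl.
by have /setIdP[_ /eqP levx] := subsetP sB x Bx; rewrite /level_weight levx.
Qed.

Lemma level_regular (T : finType) (h : nat) (H : lgraph T h) (lev : T -> nat)
    (C : rat) (d : nat) :
    (forall x i, x \in layer H i -> lev x = i) ->
    (0 < d)%N ->
    (forall x, x \in vertices H -> (0 < lev x)%N -> #|imV H x| = d) ->
    (forall x, x \in vertices H -> (lev x < h)%N -> #|im H x|%:R = C * d%:R) ->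
  regular_of_ratio C H.
Proof.
move=> levE d_gt0 din dout; exists d; split=> // x /setDP[Vx xL]; have /bigcupP[i _ xi] := Vx.
  apply: din; rewrite // (levE x i xi) lt0n; apply: contraNneq xL => i0.
  by rewrite (_ : ord0 = i) //; apply/val_inj.
apply: dout; rewrite // (levE x i xi) ltn_neqAle -ltnS ltn_ord andbT.
apply: contraNneq xL => ih.
by rewrite (_ : ord_max = i) //; apply/val_inj.
Qed.

(** * Minimal tight sets *)

Section Tight.

Variables (C : rat) (T : finType) (h : nat) (G : lgraph T h).
Hypothesis h_gt1 : (1 < h)%N.
Hypothesis C_gt0 : 0 < C.
Hypothesis commG : commutative_graph G.
Hypothesis D1 : D G 1 = C.
Hypothesis Dh : D G h = C ^+ h.
Variable Z : {set T}.
Hypothesis Z_neq0 : Z != set0.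
Hypothesis sZ0 : Z \subset layer G ord0.
Hypothesis tightZ : #|im_iter G 1 Z|%:R = C * #|Z|%:R.
Hypothesis minZ : forall B : {set T}, B != set0 -> B \subset layer G ord0 ->
  #|im_iter G 1 B|%:R = C * #|B|%:R -> (#|Z| <= #|B|)%N.

Let H := channel G Z.
Local Notation V := (vertices H).
Local Notation lev := (level G).
Let layG : layered G.
Proof. by case: commG. Qed.
Local Notation L := (level_set V lev).
Local Notation w := (level_weight C lev).

Lemma tight_mem_top x : x \in im_iter G h Z -> x \in layer G ord_max.
Proof.
move=> /im_iterP[z [p [Zz ep lp sp]]].
have levx : level G x = h.
  by rewrite -lp (path_level layG ep) sp (level_source layG sZ0 Zz).
apply: level_layer => //.
case/lastP: p ep lp sp => [|p y] ep lp sp; first by have : (1 < size (@nil T))%N by rewrite sp.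
move: ep lp; rewrite rcons_path last_rcons => /andP[_ ey] <-.
by have /andP[] := edge_vertices layG ey.
Qed.

Lemma tight_L0 : L 0 = Z.
Proof.
rewrite (channel_level_set commG sZ0 ord0) channel_layer //; apply/setP=> z.
rewrite !in_setI; apply/and3P/idP => [[zL /reach0P[z0 [p [Zz0 ep lp]]] _]|Zz].
  have := path_level layG ep; rewrite lp (levelE layG zL) (level_source layG sZ0 Zz0).
  by case: p lp {ep} => //= <-.
split; [exact: (subsetP sZ0) | by rewrite reach_src ?inE |].
(* The bound [D_h = C^h > 0] applied to the singleton of [z] provides a path from [z] to the top. *)
have z0 : [set z] != set0 by apply/set0Pn; exists z; rewrite inE.
have sz : [set z] \subset layer G ord0 by rewrite sub1set (subsetP sZ0).
have : 0 < #|im_iter G h [set z]|%:R :> rat.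
  by apply: lt_le_trans (D_le h z0 sz); rewrite Dh cards1 mulr1 exprn_gt0.
rewrite ltr0n => /card_gt0P[x] /im_iterP[z1 [p [/set1P -> ep lp sp]]].
apply/converse_reach0P; exists p => //; apply: tight_mem_top.
by apply/im_iterP; exists z, p; rewrite lp.
Qed.

Lemma tight_path z p : z \in Z -> path (edge G) z p -> size p = h -> path (edge H) z p.
Proof.
move=> Zz ep sp; have : z \in reach (edge G) Z set0 by rewrite reach_src ?inE.
have : last z p \in layer G ord_max.
  by apply: tight_mem_top; apply/im_iterP; exists z, p.
elim: p z {Zz sp} ep => //= y p IHp z /andP[ezy ep] topp zr.
have yr := from_step ezy zr.
rewrite IHp // andbT; apply/channel_edgeP => //; split=> //.
by apply/converse_reach0P; exists p.
Qed.

Lemma tight_expand_top (B : {set T}) : B \subset L 0 ->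
  weight w B <= weight w (L h :&: reach (edge H) B set0).
Proof.
move=> sB; have [->|B0] := eqVneq B set0.
  by rewrite weight_set0; exact/weight_ge0/level_weight_gt0.
have sBZ : B \subset Z by rewrite -tight_L0.
rewrite (weight_sub_level_set _ sB) (weight_sub_level_set _ (subsetIl _ _)).
rewrite divr1 ler_pdivlMr ?exprn_gt0 // mulrC -Dh.
apply: le_trans (D_le h B0 (subset_trans sBZ sZ0)) _; rewrite ler_nat.
apply/subset_leq_card/subsetP=> x /im_iterP[z [p [Bz ep lp sp]]].
have Zz := subsetP sBZ z Bz; have epH := tight_path Zz ep sp.
have xr : x \in reach (edge H) B set0 by apply/reach0P; exists z, p.
have xt : x \in layer G ord_max.
  by apply: tight_mem_top; apply/im_iterP; exists z, p.
rewrite in_setI xr andbT (channel_level_set commG sZ0 ord_max) channel_layer //.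
rewrite !in_setI xt /=; apply/andP; split.
  by apply/reach0P; exists z, p.
by rewrite reach_src ?inE.
Qed.

Lemma tight_sub1 : L 1 \subset im_iter G 1 Z.
Proof.
apply/subsetP=> x /setIdP[Vx /eqP levx].
have [|y eyx] := channel_has_in commG sZ0 Vx; first by rewrite levx.
have /channel_edgeP-/(_ layG sZ0)[eyxG _ _] := eyx.
apply/im_iter1P; exists y => //; rewrite -tight_L0 in_sep (channel_V_l commG sZ0 eyx).
by rewrite -eqSS -(edge_level layG eyxG) levx.
Qed.

Lemma tight_weight1 : weight w (L 1) <= weight w (L 0).
Proof.
rewrite !(weight_sub_level_set _ (subxx _)) divr1 tight_L0.
by rewrite ler_pdivrMr // mulrC -tightZ ler_nat subset_leq_card // tight_sub1.
Qed.

Let h_gt0 := ltnW h_gt1.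

(** No out-neighbour of [Z] is lost in the channel: equality of layer weights gives [L 1] the
    cardinality [C * #|Z|], which is that of the whole image. *)
Lemma tight_level1 : L 1 = im_iter G 1 Z.
Proof.
have eqw := weight_level_set C_gt0 h_gt1 (channel_V_l commG sZ0) (channel_V_r commG sZ0)
  (channel_levS commG sZ0) (fun x _ => level_le G x) (channel_has_out commG sZ0)
  (channel_has_in commG sZ0) (channel_upward commG sZ0) (channel_downward commG sZ0)
  tight_expand_top tight_weight1 h_gt0.
apply/eqP; rewrite eqEcard tight_sub1 -(ler_nat rat) tightZ -tight_L0.
move: eqw; rewrite !(weight_sub_level_set _ (subxx _)) divr1 expr1 => <-.
by rewrite mulrC divfK ?gt_eqF /=.
Qed.

(** For nonempty [B] the image has at most [C * #|B|] elements, and at least as many because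
    [D_1 = C]. So [B] is tight, and the least cardinality of [Z] forces [B = Z]. *)
Lemma tight_irreducible (B Y : {set T}) : B \subset L 0 ->
    (forall u v, u \in B -> edge H u v -> v \in Y) -> weight w Y <= weight w B ->
  B = set0 \/ B = L 0.
Proof.
move=> sB imB leYB; have [->|B0] := eqVneq B set0; [by left | right].
have sBZ : B \subset Z by rewrite -tight_L0.
have sB0 := subset_trans sBZ sZ0.
have sB1 : im_iter G 1 B \subset L 1.
  rewrite tight_level1; apply/subsetP=> y /im_iter1P[z Bz ezy].
  by apply/im_iter1P; exists z => //; apply: (subsetP sBZ).
have sBY : im_iter G 1 B \subset Y.
  apply/subsetP=> y yB; have /im_iter1P[z Bz ezy] := yB.
  have /setIdP[] := subsetP sB1 y yB.
  rewrite channel_vertices // !in_setI => /and3P[_ _ yt] _.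
  apply: (imB z y Bz); apply/channel_edgeP => //; split=> //.
  by rewrite reach_src ?inE ?(subsetP sBZ).
apply/eqP; rewrite tight_L0 eqEcard sBZ; apply: minZ => //.
have := D_le 1 B0 sB0; rewrite D1 => leB; apply/le_anti; rewrite leB andbT.
have w_gt0 := level_weight_gt0 lev C_gt0.
have := le_trans (weightS w_gt0 sBY) leYB.
rewrite (weight_sub_level_set _ sB) (weight_sub_level_set _ sB1) divr1.
by rewrite ler_pdivrMr // mulrC.
Qed.

Lemma tight_channel : commutative_graph H /\ regular_of_ratio C H.
Proof.
have L0_neq0 : L 0 != set0 by rewrite tight_L0.
have [d [d_gt0 din dout]] := levels_regular C_gt0 h_gt1 (channel_V_l commG sZ0)
  (channel_V_r commG sZ0) (channel_levS commG sZ0) (fun x _ => level_le G x)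
  (channel_has_out commG sZ0) (channel_has_in commG sZ0) (channel_upward commG sZ0)
  (channel_downward commG sZ0) L0_neq0 tight_expand_top tight_weight1 tight_irreducible.
split.
  by apply: channel_commutative => //; rewrite -(channel_level_set commG sZ0 ord0).
apply: (level_regular (lev := level G)) d_gt0 din dout => x i.
by rewrite channel_layer // => /setIP[/(levelE layG)].
Qed.

End Tight.

Theorem theorem4 (C : rat) (T : finType) (h : nat) (G : lgraph T h)
    (h_neq1 : h != 1%N) (C_gt0 : 0 < C)
    (commG : commutative_graph G)
    (DG : forall i : nat, (1 <= i <= h)%N -> D G i = C ^+ i) :
  exists Z : {set T},
    [/\ Z != set0,
        Z \subset layer G ord0,
        commutative_graph (channel G Z)
      & regular_of_ratio C (channel G Z)].
Proof.
have [layG _ _] := commG; have [G0 _ _] := layG.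
case: h => [|[//|h]] in G h_neq1 commG DG layG G0 *.
  (* At level 0 bottom and top coincide, the degree conditions are vacuous, and [d = 1] is an
     arbitrary choice. *)
  have eq0 (i : 'I_1) : i = ord0 by apply/val_inj; case: i => -[].
  exists (layer G ord0); split=> //.
    apply: channel_commutative => //; have [z zG] := set0Pn _ G0.
    apply/set0Pn; exists z; rewrite channel_layer // !in_setI zG.
    by rewrite !reach_src ?inE ?(eq0 ord_max).
  apply: (level_regular (lev := level G) (d := 1)) => //.
  - by move=> x i; rewrite channel_layer // => /setIP[/(levelE layG)].
  - by move=> x _; rewrite ltnNge level_le.
have D1 : D G 1 = C by rewrite DG.
have Dh : D G h.+2 = C ^+ h.+2 by rewrite DG // leqnn.
pose P (Z : {set T}) := [&& Z != set0, Z \subset layer G ord0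
  & #|im_iter G 1 Z|%:R == C * #|Z|%:R].
have [Z0 [Z0_neq0 sZ0 tightZ0]] := D_attained 1 G0.
have PZ0 : P Z0 by rewrite /P Z0_neq0 sZ0 tightZ0 D1 eqxx.
(* A set attaining [D_1 = C] exists; one of least cardinality is the required [Z]. *)
case: (arg_minnP (fun Z : {set T} => #|Z|) PZ0) => Z /and3P[Z_neq0 sZ /eqP tightZ] minZ.
exists Z; have [] // := tight_channel (ltn0Sn _ : (1 < h.+2)%N) C_gt0 commG D1 Dh Z_neq0 sZ tightZ.
by move=> B B0 sB tightB; apply: minZ; rewrite /P B0 sB tightB eqxx.
Qed.
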